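(* Let $H$ be a finite $k$-edge-colored graph (loops and multiple edges allowed), with colors $\mathbb{Z}_k=\{1,\dots,k\}$, and let $\eta$ be a function from $V(H)$ into the positive integers such that for each $w\in V(H)$, $\eta(w)=1$ implies $\ell_H(w)=0$. Then there exists a loopless $\eta$-detachment $G$ of $H$ with amalgamation function $\psi:V(G)\rightarrow V(H)$, $\eta$ being the number function associated with $\psi$ (i.e. $|\psi^{-1}(w)|=\eta(w)$ for all $w$), such that $G$ (with the edge-coloring induced from $H$) satisfies: (A1) $d_G(u)\approx d_H(w)/\eta(w)$ for each $w\in V(H)$ and each $u\in\psi^{-1}(w)$; (A2) $d_{G(j)}(u)\approx d_{H(j)}(w)/\eta(w)$ for each $w\in V(H)$, each $u\in\psi^{-1}(w)$ and each $j\in\mathbb{Z}_k$; (A3) $m_G(u,u')\approx \ell_H(w)/\binom{\eta(w)}{2}$ for each $w\in V(H)$ with $\eta(w)\ge 2$ and every pair of distinct vertices $u,u'\in\psi^{-1}(w)$; (A4) $m_{G(j)}(u,u')\approx \ell_{H(j)}(w)/\binom{\eta(w)}{2}$ for each $w\in V(H)$ with $\eta(w)\ge2$, every pair of distinct $u,u'\in\psi^{-1}(w)$ and each $j\in\mathbb{Z}_k$; (A5) $m_G(u,v)\approx m_H(w,z)/(\eta(w)\eta(z))$ for every pair of distinct $w,z\in V(H)$, each $u\in\psi^{-1}(w)$ and each $v\in\psi^{-1}(z)$; (A6) $m_{G(j)}(u,v)\approx m_{H(j)}(w,z)/(\eta(w)\eta(z))$ for every pair of distinct $w,z\in V(H)$,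 each $u\in\psi^{-1}(w)$, each $v\in\psi^{-1}(z)$ and each $j\in\mathbb{Z}_k$; (A7) if for some $j\in\mathbb{Z}_k$, $d_{H(j)}(w)/\eta(w)$ is an even integer for each $w\in V(H)$, then $\omega(G(j))=\omega(H(j))$.
   Context: Graphs are finite, undirected, and may have loops and multiple edges; a loop at $u$ is the multiset $\{u,u\}$. A $k$-edge-coloring is a map from the edge set to a set of $k$ colors. A graph $H$ is an amalgamation of $G$ if there is a surjection $\phi:V(G)\to V(H)$ (amalgamation function) and a bijection $\phi':E(G)\to E(H)$ such that $e$ joins $u$ and $v$ in $G$ iff $\phi'(e)$ joins $\phi(u)$ and $\phi(v)$ in $H$ (so edges between distinct vertices with the same image become loops); its number function is $\eta(v)=|\phi^{-1}(v)|$. $G$ is then a detachment of $H$, and an $\eta$-detachment if $|\phi^{-1}(u)|=\eta(u)$ for all $u\in V(H)$. An edge-coloring of $H$ induces one on $G$ via $\phi'$. For real $x,y$, $x\approx y$ means $\lfloor y\rfloor\le x\le\lceil y\rceil$. $\ell(u)$ is the number of loops at $u$; $d(u)$ is the degree of $u$, with a loop contributing $2$; $m(u,v)$ is the number of edges joining $u$ and $v$. $G(j)$ is the subgraph of $G$ induced by the edges colored $j$ (the edges of color $j$ together with their endpoints), and $\omega(\cdot)$ denotes the number of connected components. *)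

(* Defs.v *)
From HB Require Import structures.
From mathcomp Require Import all_boot all_order all_algebra.

Set Implicit Arguments.
Unset Strict Implicit.
Unset Printing Implicit Defensive.

Import Order.TTheory GRing.Theory Num.Theory.
Local Open Scope ring_scope.

(* The order of the two ends of an edge carries no meaning: apart from being
   counted in the degree, ends are only inspected through the symmetric
   predicate [joins].  A loop at u has ends (u, u). *)
Record mgraph := MGraph {
  vertex : finType;
  edge : finType;
  ends : edge -> vertex * vertex }.

Definition joins (G : mgraph) (e : edge G) (u v : vertex G) : bool :=
  (ends e == (u, v)) || (ends e == (v, u)).

Definition incident (G : mgraph) (e : edge G) (u : vertex G) : bool :=
  ((ends e).1 == u) || ((ends e).2 == u).

Record subgraph (G : mgraph) := Subgraph {
  verts : {set vertex G};
  edges : {set edge G};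
  edges_closed : forall e u, e \in edges -> incident e u -> u \in verts }.

Lemma whole_closed (G : mgraph) (e : edge G) (u : vertex G) :
  e \in [set: edge G] -> incident e u -> u \in [set: vertex G].
Proof. by rewrite !inE. Qed.

Definition whole (G : mgraph) : subgraph G := Subgraph (@whole_closed G).

Section ColorClass.
Variables (G : mgraph) (k : nat) (c : edge G -> 'I_k) (j : 'I_k).

Definition color_edges : {set edge G} := [set e | c e == j].

Definition color_verts : {set vertex G} :=
  [set u | [exists e in color_edges, incident e u]].

Lemma color_closed (e : edge G) (u : vertex G) :
  e \in color_edges -> incident e u -> u \in color_verts.
Proof. by move=> ej eu; rewrite inE; apply/existsP; exists e; rewrite ej. Qed.

(* The subgraph G(j): it has no isolated vertices. *)
Definition color_class : subgraph G := Subgraph color_closed.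

End ColorClass.

Section Counts.
Variables (G : mgraph) (S : subgraph G).

(* Vertices of G outside S get degree 0.  Both ends of an edge are counted, so
   that a loop contributes 2. *)
Definition deg (u : vertex G) : nat :=
  (\sum_(e in edges S) (((ends e).1 == u) + ((ends e).2 == u)))%N.

Definition loops (u : vertex G) : nat := #|[set e in edges S | joins e u u]|.

Definition mult (u v : vertex G) : nat := #|[set e in edges S | joins e u v]|.

Definition adj : rel (vertex G) :=
  fun u v => [exists e in edges S, joins e u v].

Definition ncomponents : nat := n_comp adj (verts S).

End Counts.

Definition loopless (G : mgraph) : Prop :=
  forall u : vertex G, loops (whole G) u = 0%N.

(* The edge f e of H joins exactly the images of the ends of e.  (Asking that
   e join u and v as soon as f e joins phi u and phi v, for all u and v, would
   be too strong: it would exclude splitting any non-isolated vertex.) *)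
Definition amalgamation (G H : mgraph)
    (phi : vertex G -> vertex H) (f : edge G -> edge H) : Prop :=
  [/\ forall w : vertex H, exists u : vertex G, phi u = w,
      bijective f
    & forall (e : edge G) (w z : vertex H),
        joins (f e) w z <->
        exists u v : vertex G, [/\ phi u = w, phi v = z & joins e u v]].

Definition number_function (G H : mgraph) (phi : vertex G -> vertex H)
    (w : vertex H) : nat := #|[set u | phi u == w]|.

Definition approx (R : archiRealFieldType) (x y : R) : Prop :=
  (Num.floor y)%:~R <= x <= (Num.ceil y)%:~R.

Definition even_integer (R : archiRealFieldType) (x : R) : Prop :=
  exists q : int, x = (2 * q)%:~R.

(* Main.v *)
(* G is reached from H by splitting off one vertex at a time: as long as some y
   has eta y >= 2, a set D of half-edges at y is moved to a new vertex, which gets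
   eta = 1, while y keeps eta y - 1.  Every set P of half-edges at y that matters
   (all of them, a color, a neighbor, a neighbor within a color, a loop, and the
   edges from y to one component of a color class minus y) should satisfy
   floor(|P| / eta y) <= |P :&: D| <= ceil(|P| / eta y).  These sets form two
   laminar families, and such a D exists for any two laminar families: start
   from the constant vector 1 / eta y and, as long as some entry is fractional,
   move along a vector that annihilates the sets of integral weight, until one
   more set gets an integral weight.  Such a vector exists because the sets of
   integral weight of one laminar family impose at most |F| / 2 independent
   conditions on the fractional entries F, and if both families impose |F| / 2
   then the conditions are dependent.

   Balance is preserved because (a - t) / (n - 1) lies between floor(a / n) and
   ceil(a / n) whenever t does.  If all degrees of a color class are even, then y
   sends an even number of edges to each component of the class minus y, so at
   least one of them stays at y when D is removed, and no component falls
   apart. *)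
Require Import Defs.
From HB Require Import structures.
From mathcomp Require Import all_boot all_order all_algebra.
From mathcomp Require Import zify.

Set Implicit Arguments.
Unset Strict Implicit.
Unset Printing Implicit Defensive.

Import Order.TTheory GRing.Theory Num.Theory.
Local Open Scope ring_scope.

(** * Equitable subsets for two laminar families *)

(** There are fewer equations than unknowns: the incidence matrix of [F] against [K] has rank at
    most #|K|, so its left kernel is nonzero. *)
Lemma kernel_of_few_sets (S : finType) (F : {set S}) (K : {set {set S}}) :
  (#|K| < #|F|)%N ->
  exists d : S -> rat,
    [/\ exists s, d s != 0,
        forall s, s \notin F -> d s = 0
      & forall P, P \in K -> \sum_(s in P) d s = 0].
Proof.
move=> ltKF.
pose M : 'M[rat]_(#|F|, #|K|) :=
  \matrix_(i, l) (enum_val i \in (enum_val l : {set S}))%:R.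
have /rowV0Pn[u /sub_kermxP uM /rV0Pn[i0 ui0]] : kermx M != 0.
  by rewrite -mxrank_eq0 mxrank_ker -lt0n subn_gt0 (leq_ltn_trans (rank_leq_col M)).
(* The kernel vector, extended by zero outside [F]. *)
exists (fun s => \sum_i u 0 i *+ (enum_val i == s)); split.
- exists (enum_val i0); rewrite (bigD1 i0) //= eqxx big1 ?addr0 //.
  by move=> i /negPf ii0; rewrite (inj_eq enum_val_inj) ii0.
- move=> s sF; apply: big1 => i _; case: eqP => // is_; case/negP: sF.
  by rewrite -is_ enum_valP.
- move=> P PK; rewrite exchange_big /=.
  have := congr1 (fun v : 'rV__ => v 0 (enum_rank_in PK P)) uM.
  rewrite /= !mxE => e0; rewrite -[RHS]e0; apply: eq_bigr => i _.
  rewrite mxE enum_rankK_in //.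
  case: (boolP (enum_val i \in P)) => iP.
    rewrite (bigD1 (enum_val i)) //= eqxx big1 ?addr0 ?mulr1 //.
    by move=> s /andP[_ /negPf]; rewrite eq_sym => ->.
  rewrite mulr0 big1 // => s sP; case: eqP => // is_; by rewrite is_ sP in iP.
Qed.

(** Each packing has at most |F| / 2 members. If the union has fewer than |F| members, counting
    suffices; otherwise both packings partition [F], and one condition follows from the others. *)
Lemma kernel_of_two_packings (S : finType) (F : {set S}) (K L : {set {set S}}) :
  F != set0 -> trivIset K -> trivIset L ->
  (forall P, P \in K -> P \subset F /\ (2 <= #|P|)%N) ->
  (forall P, P \in L -> P \subset F /\ (2 <= #|P|)%N) ->
  exists d : S -> rat,
    [/\ exists s, d s != 0,
        forall s, s \notin F -> d s = 0
      & forall P, P \in K :|: L -> \sum_(s in P) d s = 0].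
Proof.
move=> F0 tK tL hK hL.
have cov (M : {set {set S}}) : trivIset M ->
    (forall P, P \in M -> P \subset F /\ (2 <= #|P|)%N) ->
    (cover M \subset F) /\ (#|M| * 2 <= #|cover M|)%N.
  move=> tM hM; split; first by apply/bigcupsP => P /hM[].
  rewrite -(eqP tM) -sum_nat_const; apply: leq_sum => P /hM[]//.
have [sK cK] := cov _ tK hK; have [sL cL] := cov _ tL hL.
have [lt|ge] := ltnP #|K :|: L| #|F|; first exact: kernel_of_few_sets.
have leU := (leq_card_setU K L).1.
have lK := subset_leq_card sK; have lL := subset_leq_card sL.
have eK : cover K = F by apply/eqP; rewrite eqEcard sK /=; lia.
have eL : cover L = F by apply/eqP; rewrite eqEcard sL /=; lia.
have [P0 P0K] : exists P0, P0 \in K.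
  by apply/set0Pn; apply: contraNneq F0 => K0; rewrite -eK K0 /cover big_set0.
have F1 : (0 < #|F|)%N by rewrite card_gt0.
have [|d [d0 dF dP]] := @kernel_of_few_sets _ F ((K :\ P0) :|: L).
  have := (leq_card_setU (K :\ P0) L).1; have := cardsD1 P0 K; rewrite P0K add1n; lia.
exists d; split => // P; have [-> _|nP PKL] := eqVneq P P0; last first.
  by apply: dP; rewrite !inE nP; rewrite !inE in PKL.
(* The dropped condition at [P0] is recovered by summing over [F] in two ways: the blocks of [L]
   give 0, and so do all blocks of [K] other than [P0]. *)
have : \sum_(s in cover K) d s = \sum_(s in cover L) d s by rewrite eK eL.
rewrite !big_trivIset //= [RHS]big1 => [|Q QL]; last by apply: dP; rewrite inE QL orbT.
rewrite (bigD1 P0) //= [X in _ + X]big1 ?addr0 // => Q /andP[QK nQ].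
by apply: dP; rewrite !inE nQ QK.
Qed.

Definition nested (S : finType) (P Q : {set S}) : bool :=
  [|| P \subset Q, Q \subset P | [disjoint P & Q]].

Lemma nestedC (S : finType) (P Q : {set S}) : nested P Q = nested Q P.
Proof. by rewrite /nested orbCA disjoint_sym. Qed.

Lemma nested_disjoint (S : finType) (P Q : {set S}) :
  (forall s, s \in P -> s \in Q -> False) -> nested P Q.
Proof.
move=> PQ; apply/or3P/Or33; rewrite -setI_eq0; apply/eqP/setP => s.
by rewrite !inE; apply/negP => /andP[/PQ].
Qed.

Definition laminar (S : finType) (T : {set {set S}}) : Prop :=
  forall P Q, P \in T -> Q \in T -> nested P Q.

(** Assign each element to the smallest member of [T] containing it. The fractional elements
    assigned to a common member form a core; the nonempty cores are the packing, and every member of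
    [T] is a disjoint union of such fibers. *)
Lemma laminar_packing (S : finType) (T : {set {set S}}) (x : S -> rat) :
  laminar T -> (forall P, P \in T -> \sum_(s in P) x s \is a Num.int) ->
  exists K : {set {set S}},
    [/\ trivIset K,
        forall P, P \in K ->
          P \subset [set s | x s \isn't a Num.int] /\ (2 <= #|P|)%N
      & forall d : S -> rat,
          (forall s, s \notin [set s | x s \isn't a Num.int] -> d s = 0) ->
          (forall P, P \in K -> \sum_(s in P) d s = 0) ->
          forall P, P \in T -> \sum_(s in P) d s = 0].
Proof.
move=> lamT intT; set F := [set s | _].
(* [setT] is the default for elements that lie in no member of [T]. *)
pose m s := [arg min_(Q < [set: S] | (Q == setT) || (Q \in T) && (s \in Q)) #|Q|].
have mP s : [/\ s \in m s, m s = setT \/ m s \in T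
              & forall Q, Q \in T -> s \in Q -> m s \subset Q].
  rewrite /m; case: arg_minnP => [|M hM minM]; first by rewrite eqxx.
  have sM : s \in M by case/orP: hM => [/eqP->|/andP[]//]; rewrite inE.
  split=> // [|Q QT sQ].
    by case/orP: hM => [/eqP|/andP[]]; [left|right].
  have leMQ : (#|M| <= #|Q|)%N by apply: minM; rewrite QT sQ orbT.
  have sQM : Q \subset M -> M \subset Q.
    by move=> QM; have /eqP-> : Q == M by rewrite eqEcard QM.
  case/orP: hM => [/eqP M1|/andP[MT _]]; first by apply: sQM; rewrite M1 subsetT.
  case/or3P: (lamT _ _ MT QT) => // /disjoint_setI0/setP/(_ s).
  by rewrite !inE sM sQ.
have decomp (f : S -> rat) Q : Q \in T ->
    \sum_(s in Q) f s = \sum_(P | (P \in T) && (P \subset Q)) \sum_(s | m s == P) f s.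
  move=> QT; rewrite (partition_big m (fun P => (P \in T) && (P \subset Q))) /=.
    apply: eq_bigr => P /andP[PT PQ]; apply: eq_bigl => s.
    case: eqP => [msP|]; rewrite ?andbF // andbT.
    by have [sms _ _] := mP s; rewrite (subsetP PQ) // -msP.
  move=> s sQ; have [_ hT /(_ _ QT sQ) sub] := mP s; rewrite sub andbT.
  case: hT => // ms1; move: sub; rewrite ms1 subTset => /eqP Q1.
  by rewrite -Q1.
(* By induction on #|P|: the fibers of the proper subsets of [P] in [T] are removed from the
   integral weight of [P]. *)
have intcore P : P \in T -> \sum_(s | m s == P) x s \is a Num.int.
  have [n] := ubnP #|P|; elim: n P => // n IH P ltPn PT.
  have := intT _ PT; rewrite (decomp x P PT) (bigD1 P) ?PT //=.
  rewrite rpredDr // rpred_sum // => Q /andP[/andP[QT QP] nQP].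
  apply: IH => //; rewrite -ltnS; apply: leq_trans ltPn; rewrite ltnS; apply: proper_card.
  by rewrite properEneq nQP.
pose core P := [set s in F | m s == P].
exists ((core @: T) :\ set0); split.
- apply/trivIsetP => _ _ /setD1P[_ /imsetP[P _ ->]] /setD1P[_ /imsetP[Q _ ->]].
  apply: contraNT; case/pred0Pn=> s /=; rewrite !inE.
  by case/andP=> /andP[_ /eqP<-] /andP[_ /eqP<-].
- move=> C /setD1P[n0 /imsetP[P PT eC]]; rewrite {C}eC in n0 *; split.
    by apply/subsetP => s; rewrite inE => /andP[].
  (* A core with one element would leave a single fractional term in an integral sum. *)
  rewrite ltnNge leq_eqVlt ltnS leqn0 cards_eq0 (negPf n0) orbF.
  apply/negP => /cards1P[s0 eq0].
  have : s0 \in core P by rewrite eq0 set11.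
  rewrite !inE => /andP[/negP xs0 ms0]; apply: xs0.
  have := intcore _ PT; rewrite (bigD1 s0) //= rpredDr // rpred_sum // => s.
  case/andP=> msP ns; apply: contraNT ns => xs.
  by rewrite -in_set1 -eq0 !inE xs.
- move=> d dF dK P PT; rewrite (decomp d P PT) big1 // => Q /andP[QT _].
  rewrite (bigID (mem F)) /= addrC big1 ?add0r => [|s /andP[_ /dF]//].
  have -> : \sum_(i | (m i == Q) && (i \in F)) d i = \sum_(s in core Q) d s.
    by apply: eq_bigl => s; rewrite !inE andbC.
  have [->|n0] := eqVneq (core Q) set0; first by rewrite big_set0.
  by apply: dK; rewrite in_setD1 n0 imset_f.
Qed.

Lemma laminar_sub (S : finType) (T T' : {set {set S}}) :
  T' \subset T -> laminar T -> laminar T'.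
Proof. by move=> /subsetP sT lamT P Q /sT PT /sT QT; apply: lamT. Qed.

Definition nonintegral (S : finType) (C : {set {set S}}) (x : S -> rat) :=
  [set P in C | \sum_(s in P) x s \isn't a Num.int].

(** Moving along a kernel direction keeps integral weights fixed. Stopping as soon as some other
    weight reaches an integer ensures that no weight crosses an integer. *)
Lemma rounding_step (S : finType) (A B : {set {set S}}) (x : S -> rat) :
  laminar A -> laminar B -> (forall s, [set s] \in A) ->
  (exists s, x s \isn't a Num.int) ->
  exists x' : S -> rat,
    (forall P, P \in A :|: B -> forall q : int,
       (q%:~R <= \sum_(s in P) x s -> q%:~R <= \sum_(s in P) x' s) /\
       (\sum_(s in P) x s <= q%:~R -> \sum_(s in P) x' s <= q%:~R)) /\
    (#|nonintegral (A :|: B) x'| < #|nonintegral (A :|: B) x|)%N.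
Proof.
move=> lamA lamB sing [s1 xs1].
pose tight (C : {set {set S}}) := [set P in C | \sum_(s in P) x s \is a Num.int].
have sub C : tight C \subset C by apply/subsetP => P; rewrite inE => /andP[].
have int C P : P \in tight C -> \sum_(s in P) x s \is a Num.int.
  by rewrite inE => /andP[].
have [KA [tA hA dA]] := laminar_packing (laminar_sub (sub A) lamA) (@int A).
have [KB [tB hB dB]] := laminar_packing (laminar_sub (sub B) lamB) (@int B).
set F := [set s | x s \isn't a Num.int] in hA dA hB dB.
have F0 : F != set0 by apply/set0Pn; exists s1; rewrite inE.
have [d [[s0 ds0] dF dK]] := kernel_of_two_packings F0 tA tB hA hB.
pose X (P : {set S}) := \sum_(s in P) x s; pose Y (P : {set S}) := \sum_(s in P) d s.
have Y0 P : P \in A :|: B -> X P \is a Num.int -> Y P = 0.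
  case/setUP=> PC XP.
    by apply: dA => [//|Q QK|]; [apply: dK; rewrite inE QK|rewrite inE PC].
  by apply: dB => [//|Q QK|]; [apply: dK; rewrite inE QK orbT|rewrite inE PC].
(* [b P] is the integer towards which the weight of [P] moves, and [t P] is the time at which it
   arrives; [P0] is the first set to arrive. *)
pose b P : rat := if 0 < Y P then (Num.ceil (X P))%:~R else (Num.floor (X P))%:~R.
pose t P := (b P - X P) / Y P.
have [P0 /andP[P0U YP0] minP0] : exists2 P0, (P0 \in A :|: B) && (Y P0 != 0)
    & forall P, (P \in A :|: B) && (Y P != 0) -> t P0 <= t P.
  (* Some set does move: the singleton of an element where [d] is nonzero. *)
  have s0U : ([set s0] \in A :|: B) && (Y [set s0] != 0).
    by rewrite inE sing /Y big_set1.
  case: (@arg_minP _ _ _ [set s0]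
             [pred P : {set S} | (P \in A :|: B) && (Y P != 0)] t s0U) => P0 hP0 minP0.
  by exists P0.
have bX P : Y P != 0 -> b P = X P + t P * Y P.
  by move=> YP; rewrite /t divfK // addrC subrK.
have t0 : 0 <= t P0.
  rewrite /t /b; case: ifPn => [Y1|]; first by rewrite divr_ge0 ?subr_ge0 ?ceil_ge // ltW.
  rewrite -leNgt => Y1; rewrite -mulrNN -invrN divr_ge0 ?oppr_ge0 // subr_le0.
  exact: floor_le.
exists (fun s => x s + t P0 * d s).
have X'E (P : {set S}) : \sum_(s in P) (x s + t P0 * d s) = X P + t P0 * Y P.
  by rewrite big_split /= -mulr_sumr.
have XX (P : {set S}) :
    X P \is a Num.int -> P \in A :|: B -> X P + t P0 * Y P \is a Num.int.
  by move=> XP PU; rewrite Y0 // mulr0 addr0.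
split=> [P PU q|]; rewrite ?X'E.
  have [->|YP] := eqVneq (Y P) 0; first by rewrite mulr0 addr0.
  have le := minP0 P; rewrite PU YP in le; have {le} := le isT.
  have := bX P YP; rewrite -/(X P) /b; case: ifPn => [Y1|]; last rewrite -leNgt => Y1.
    move=> bP lt0; split=> [qX|Xq].
      by apply: le_trans qX _; rewrite lerDl mulr_ge0 // ltW.
    have : (Num.ceil (X P))%:~R <= (q%:~R : rat) by rewrite ler_int ceil_le_int.
    by rewrite bP; apply: le_trans; rewrite lerD2l ler_wpM2r // ltW.
  move=> bP lt0; split=> [qX|Xq]; last first.
    by apply: le_trans Xq; rewrite gerDl mulr_ge0_le0.
  have : (q%:~R : rat) <= (Num.floor (X P))%:~R by rewrite ler_int floor_ge_int.
  by rewrite bP => /le_trans; apply; rewrite lerD2l ler_wnM2r.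
apply: proper_card; apply/properP; split.
  apply/subsetP => P; rewrite ![_ \in nonintegral _ _]inE X'E => /andP[PU].
  by rewrite PU; apply: contraNN => /XX; apply.
exists P0; rewrite [_ \in nonintegral _ _]inE P0U /= ?X'E.
  by apply: contraNN YP0 => /Y0->.
by rewrite negbK -bX // /b; case: ifP => _; apply: intr_int.
Qed.

Lemma laminar_rounding (S : finType) (A B : {set {set S}}) (x : S -> rat) :
  laminar A -> laminar B -> (forall s, [set s] \in A) ->
  exists z : S -> int,
    forall P, P \in A :|: B -> forall q : int,
      (q%:~R <= \sum_(s in P) x s -> q <= \sum_(s in P) z s) /\
      (\sum_(s in P) x s <= q%:~R -> \sum_(s in P) z s <= q).
Proof.
move=> lamA lamB sing.
have [n] := ubnP #|nonintegral (A :|: B) x|; elim: n x => // n IH x ltN.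
have [/existsP exx|allx] := boolP [exists s, x s \isn't a Num.int].
  have [x' [x'P lt']] := rounding_step lamA lamB sing exx.
  have [|z zP] := IH x'; first by apply: leq_trans lt' _; rewrite -ltnS.
  exists z => P PU q; have [h1 h2] := x'P P PU q; have [g1 g2] := zP P PU q.
  by split=> h; [apply/g1/h1|apply/g2/h2].
exists (fun s => Num.floor (x s)) => P _ q.
have -> : \sum_(s in P) x s = (\sum_(s in P) Num.floor (x s))%:~R.
  rewrite raddf_sum /=; apply: eq_bigr => s _; rewrite floorK //.
  by apply: contraNT allx => xs; apply/existsP; exists s.
by rewrite !ler_int.
Qed.

(** For [0 < n] this is floor(a / n) <= x <= ceil(a / n), expressed by integer bounds so that
    successive roundings compose without division. *)
Definition napprox (x a n : nat) : Prop :=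
  (forall q, q * n <= a -> q <= x)%N /\ (forall q, a <= q * n -> x <= q)%N.

Lemma equitable_subset (S : finType) (A B : {set {set S}}) (n : nat) :
  laminar A -> laminar B -> (0 < n)%N ->
  exists D : {set S}, forall P, P \in A :|: B -> napprox #|P :&: D| #|P| n.
Proof.
move=> lamA lamB n0.
(* With singletons in the family, each entry 1 / n is rounded to 0 or 1, so that the rounded vector
   is the indicator of a set. *)
pose A' := A :|: [set [set s] | s in S].
have lamA' : laminar A'.
  move=> P Q /setUP[PA|/imsetP[s _ ->]] /setUP[QA|/imsetP[s' _ ->]].
  - exact: lamA.
  - by rewrite /nested !sub1set disjoint_sym disjoints1; case: (_ \in P); rewrite ?orbT.
  - by rewrite /nested !sub1set disjoints1; case: (_ \in Q); rewrite ?orbT.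
  - by rewrite /nested !sub1set disjoints1; case: (_ \in [set s']); rewrite ?orbT.
have sing s : [set s] \in A' by rewrite inE imset_f ?orbT.
have [z zP] := laminar_rounding (fun=> n%:R^-1) lamA' lamB sing.
have sumx (P : {set S}) : \sum_(s in P) (n%:R^-1 : rat) = #|P|%:R / n%:R.
  by rewrite sumr_const mulr_natl.
have n0R : (0 : rat) < n%:R by rewrite ltr0n.
have z01 s : z s = (s \in [set s | z s == 1])%:R.
  have [|h0 _] := zP [set s] _ 0; first by rewrite inE sing.
  have [|_ h1] := zP [set s] _ 1; first by rewrite inE sing.
  rewrite !sumx !big_set1 cards1 in h0 h1; rewrite inE.
  have g1 : z s <= 1 by apply: h1; rewrite ler_pdivrMr // !mul1r ler1n.
  have g0 : 0 <= z s by apply: h0; rewrite divr_ge0 ?ler0n.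
  by case: eqP => /= z1; lia.
exists [set s | z s == 1] => P PU.
have PU' : P \in A' :|: B by case/setUP: PU => h; rewrite !inE h ?orbT.
have sumz : \sum_(s in P) z s = #|P :&: [set s | z s == 1]|%:Z.
  rewrite (eq_bigr _ (fun s _ => z01 s)) -natr_sum -sum1_card /=.
  rewrite -big_mkcondr natz.
  by congr (_%:Z); apply: eq_bigl => s; rewrite !inE.
split=> q le; have [h1 h2] := zP P PU' q%:Z; rewrite sumz sumx in h1 h2.
- by apply: h1; rewrite ler_pdivlMr // -natrM ler_nat.
- by apply: h2; rewrite ler_pdivrMr // -natrM ler_nat.
Qed.

(** * Balanced parts of a natural number *)

Lemma napprox_approx (R : archiRealFieldType) (x a n : nat) :
  (0 < n)%N -> napprox x a n -> approx (x%:R : R) (a%:R / n%:R).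
Proof.
move=> n0 [lo hi]; have n0R : (0 : R) < n%:R by rewrite ltr0n.
have an0 : (0 : R) <= a%:R / n%:R by rewrite divr_ge0.
rewrite /approx -![x%:R]/(x%:Z%:~R) !ler_int; apply/andP; split.
  have : 0 <= Num.floor (a%:R / n%:R : R) by rewrite floor_ge_int.
  have := floor_le (a%:R / n%:R : R).
  case: (Num.floor _) => // q; rewrite ler_pdivlMr // -natrM ler_nat => /lo.
  by [].
have : 0 <= Num.ceil (a%:R / n%:R : R).
  by rewrite -(ler_int R); apply: le_trans (ceil_ge _).
have := ceil_ge (a%:R / n%:R : R).
case: (Num.ceil _) => // q; rewrite ler_pdivrMr // -natrM ler_nat => /hi.
by [].
Qed.

Local Open Scope nat_scope.

Lemma napprox_refl (a : nat) : napprox a a 1.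
Proof. by split=> q; rewrite muln1. Qed.

(** Used for the new vertex: it receives a share [t] of [a], which is then divided among [m]
    vertices. *)
Lemma napprox_mul (x t a n m : nat) :
  napprox t a n -> napprox x t m -> napprox x a (n * m).
Proof.
move=> [lot hit] [lox hix]; split=> q; rewrite [n * m]mulnC mulnA => h.
  exact/lox/lot.
exact/hix/hit.
Qed.

(** Used for the old vertex. If r n <= a, then a - r (n - 1) is an integer at least a / n, hence at
    least [t], so at least r (n - 1) remain; the other bound is symmetric. *)
Lemma napprox_rest (x t a n m : nat) :
  1 < n -> t <= a ->
  napprox t a n -> napprox x (a - t) (n.-1 * m) -> napprox x a (n * m).
Proof.
case: n => [|[|n]] // _ lta [lot hit] [lox hix]; split=> q h /=.
  apply: lox => /=; set r := q * m; have {}h : r * n.+2 <= a by rewrite /r mulnAC -mulnA.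
  suff : t <= a - r * n.+1 by rewrite /r; nia.
  by apply: hit; nia.
apply: hix => /=; set r := q * m; have {}h : a <= r * n.+2 by rewrite /r mulnAC -mulnA.
suff : a - r * n.+1 <= t by rewrite /r; nia.
by apply: lot; nia.
Qed.

Lemma bin2_double (n : nat) : 2 * 'C(n, 2) = n * n.-1.
Proof. by rewrite -mul_bin_diag bin1. Qed.

(** The [l] loops have 2 l half-edges. The [t] moved ones become edges from the new vertex to the
    old one, to be divided among n - 1 vertices, and 2 l / (n (n - 1)) = l / C(n, 2). *)
Lemma napprox_loops_new (x t l n : nat) :
  napprox t (2 * l) n -> napprox x t n.-1 -> napprox x l 'C(n, 2).
Proof.
move=> [lot hit] [lox hix]; have := bin2_double n => b.
by split=> q h; [apply/lox/lot|apply/hix/hit]; nia.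
Qed.

(** Each moved half-edge destroys one loop. The bounds on [t] suffice because n C(n - 1, 2) = (n -
    2) C(n, 2). *)
Lemma napprox_loops_rest (x t l n : nat) :
  1 < n -> t <= l ->
  napprox t (2 * l) n -> napprox x (l - t) 'C(n.-1, 2) -> napprox x l 'C(n, 2).
Proof.
case: n => [|[|n]] // _ ltl [lot hit] [lox hix].
have := bin2_double n.+2; have := bin2_double n.+1; rewrite /= => b1 b2.
split=> q h; [apply: lox => /=|apply: hix => /=].
  suff : t <= l - q * 'C(n.+1, 2) by nia.
  by apply: hit; nia.
suff : l - q * 'C(n.+1, 2) <= t by nia.
by apply: lot; nia.
Qed.

(** * Half-edges *)

Lemma card_hinges (E : finType) (X : {set E}) (Q : pred (E * bool)) :
  #|[set h | (h.1 \in X) && Q h]| = \sum_(e in X) (Q (e, false) + Q (e, true)).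
Proof.
rewrite -sum1_card (eq_bigl (fun h => (h.1 \in X) && Q (h.1, h.2))); last first.
  by case=> e b; rewrite inE.
rewrite -(pair_big_dep (mem X) (fun e b => Q (e, b)) (fun _ _ => 1)) /=.
apply: eq_bigr => e _; rewrite big_mkcond big_bool /= addnC.
by case: (Q _); case: (Q _).
Qed.

Definition flip (E : Type) (h : E * bool) : E * bool := (h.1, ~~ h.2).

Lemma flipK (E : Type) : involutive (@flip E).
Proof. by case=> e b; rewrite /flip /= negbK. Qed.

Section Hinges.
Variable G : mgraph.
Implicit Types (S : subgraph G) (X : {set edge G}) (u v : vertex G).

(** A half-edge is an edge with a boolean selecting one of its ends, so a loop has two distinct
    half-edges at its vertex. *)
Definition hend (h : edge G * bool) : vertex G :=
  if h.2 then (ends h.1).2 else (ends h.1).1.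

Definition hinges X u := [set h | (h.1 \in X) && (hend h == u)].

Definition hinges2 X u v :=
  [set h | (h.1 \in X) && ((hend h == u) && (hend (flip h) == v))].

Lemma degE S u : deg S u = #|hinges (edges S) u|.
Proof. by rewrite card_hinges; apply: eq_bigr. Qed.

Lemma multE S u v : u != v -> mult S u v = #|hinges2 (edges S) u v|.
Proof.
move=> uv; rewrite card_hinges /mult -sum1_card big_mkcond /=.
rewrite [RHS]big_mkcond; apply: eq_bigr => e _; rewrite inE.
case: (e \in edges S) => //=; rewrite /joins /hend /=.
case: (ends e) => a b /=; rewrite !xpair_eqE [(b == u) && _]andbC.
have [->|_] := eqVneq a u; first by rewrite (negPf uv) orbF addn0; case: ifP.
by rewrite /=; case: ifP.
Qed.

Lemma loopsE S u : 2 * loops S u = #|hinges2 (edges S) u u|.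
Proof.
rewrite card_hinges /loops -sum1_card big_mkcond /= big_distrr /=.
rewrite [RHS]big_mkcond; apply: eq_bigr => e _; rewrite inE.
case: (e \in edges S) => //=; rewrite /joins /hend /= orbb.
case: (ends e) => a b /=; rewrite !xpair_eqE [(b == u) && _]andbC.
by case: ifP.
Qed.

Lemma multC S u v : mult S u v = mult S v u.
Proof. by apply: eq_card => e; rewrite !inE /joins orbC. Qed.

End Hinges.

(** * Connectivity, and the edges from a vertex to the components of its complement *)

Lemma connect_homo (T T' : finType) (e : rel T) (e' : rel T') (f : T -> T') :
  (forall u v, e u v -> connect e' (f u) (f v)) ->
  forall u v, connect e u v -> connect e' (f u) (f v).
Proof.
move=> ef u v /connectP[p]; elim: p u => [|w p IH] u /=; first by move=> _ ->.
by case/andP=> /ef uw /IH{}IH /IH; apply: connect_trans.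
Qed.

Section Adjacency.
Variables (G : mgraph) (S : subgraph G).
Implicit Types (u v y : vertex G).

Lemma adjP u v :
  reflect (exists h, [/\ h.1 \in edges S, hend h = u & hend (flip h) = v])
          (adj S u v).
Proof.
apply: (iffP existsP) => [[e /andP[eS]]|[[e b] [/= eS]]].
  rewrite /joins; case/orP => /eqP euv; [exists (e, false)|exists (e, true)];
  by rewrite /hend /= euv.
rewrite /hend /= => hu hv; exists e; rewrite eS /joins -hu -hv.
by case: b {hu hv} => /=; case: (ends e) => a b /=; rewrite eqxx ?orbT.
Qed.

Lemma adj_sym : symmetric (adj S).
Proof. by move=> u v; apply: eq_existsb => e; rewrite /joins orbC. Qed.

Lemma connect_sym_adj : connect_sym (adj S).
Proof. exact/sym_connect_sym/adj_sym. Qed.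

Definition adj_off y : rel (vertex G) :=
  fun u v => [&& u != y, v != y & adj S u v].

Lemma adj_off_sym y : symmetric (adj_off y).
Proof. by move=> u v; rewrite /adj_off adj_sym andbCA. Qed.

(** The half-edges at [y] whose edges lead into the component of [r] in S - y; the set is empty when
    [r] is [y]. *)
Definition wing y r : {set edge G * bool} :=
  [set h | [&& h.1 \in edges S, hend h == y, hend (flip h) != y
             & connect (adj_off y) r (hend (flip h))]].

(* Handshake on the component of r in S - y. *)
Lemma wing_even y r :
  (forall w, 2 %| deg S w) -> 2 %| #|wing y r|.
Proof.
move=> ev; pose C := [set z | (z != y) && connect (adj_off y) r z].
have sumC : 2 %| \sum_(z in C) deg S z 
    by apply: dvdn_sum => z _; apply: ev.
have e1 : \sum_(z in C) deg S z =
    #|[set h : edge G * bool | (h.1 \in edges S) && (hend h \in C)]|.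
  rewrite -sum1_card (partition_big (@hend G) (mem C)) /=; last first.
    by move=> h; rewrite inE => /andP[].
  apply: eq_bigr => z zC; rewrite degE -sum1_card; apply: eq_bigl => h.
  rewrite [h \in hinges _ _]inE [in RHS]inE -andbA.
  by case: eqP => [->|]; rewrite ?andbF // zC.
(* Edges inside [C] contribute both halves, an even number. The remaining half-edges at [C] are the
   flips of the wing. *)
pose I := [set h : edge G * bool |
  (h.1 \in edges S) && ((hend h \in C) && (hend (flip h) \in C))].
have I2 : 2 %| #|I|.
  rewrite card_hinges; apply: dvdn_sum => e _; by rewrite /flip /= andbC; case: (_ && _).
have e2 : #|wing y r| + #|I| = \sum_(z in C) deg S z.
  rewrite e1 -[RHS](cardsID [set h : edge G * bool | hend (flip h) == y]); congr (_ + _).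
    rewrite -(card_preimset (wing y r) (can_inj (@flipK (edge G)))).
    apply: eq_card => h; rewrite !inE flipK.
    by case: (h.1 \in _); case: (hend (flip h) == y); rewrite ?andbF ?andbT.
  apply: eq_card => h; rewrite !inE.
  case hS: (h.1 \in edges S) => /=; last by rewrite ?andbF.
  case hy: (hend h != y) => /=; last by rewrite ?andbF.
  case hr: (connect _ r (hend h)) => /=; last by rewrite ?andbF.
  rewrite andbT; case: eqP => //= /eqP fy.
  apply: connect_trans hr (connect1 _); rewrite /adj_off hy fy /=.
  by apply/adjP; exists h.
by rewrite -(dvdn_addl _ I2) e2.
Qed.

End Adjacency.

(** * Splitting off one vertex *)

Section Split.
Variables (G : mgraph) (y : vertex G) (D : {set edge G * bool}).
Hypothesis Dy : forall h, h \in D -> hend h = y.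
Hypothesis Dflip : forall h, h \in D -> flip h \notin D.

(** Only ends are redirected; the edge type stays the same, so colorings carry over unchanged. By
    [Dflip], a loop never has both halves moved. *)
Definition split_end (h : edge G * bool) : option (vertex G) :=
  if h \in D then None else Some (hend h).

(* None is the new vertex. *)
Definition split_graph : mgraph :=
  MGraph (fun e => (split_end (e, false), split_end (e, true))).

Lemma hend_split h : @hend split_graph h = split_end h.
Proof. by case: h => e []. Qed.

Lemma split_endK h : odflt y (split_end h) = hend h.
Proof. by rewrite /split_end; case: ifP => //= /Dy->. Qed.

Variables (S : subgraph G) (S' : subgraph split_graph).
Hypothesis SS' : edges S' = edges S.

Let t := #|hinges (edges S) y :&: D|.
Let m z := #|hinges2 (edges S) y z :&: D|.

Lemma deg_split_new : @deg split_graph S' None = t.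
Proof.
rewrite degE SS'; apply: eq_card => h; rewrite !inE hend_split /split_end -andbA.
by case: ifP => hD; rewrite ?andbF // (Dy hD) !eqxx.
Qed.

Lemma deg_split_old : @deg split_graph S' (Some y) = deg S y - t.
Proof.
rewrite !degE SS' /t -cardsD; apply: eq_card => h.
rewrite !inE hend_split /split_end.
by case: ifP => hD; rewrite ?andbF.
Qed.

Lemma deg_split_other w : w != y -> @deg split_graph S' (Some w) = deg S w.
Proof.
move=> wy; rewrite !degE SS'; apply: eq_card => h.
rewrite !inE hend_split /split_end.
by case: ifP => hD //; rewrite (Dy hD) [y == w]eq_sym (negPf wy) !andbF.
Qed.

(** The case where [z] is [y] is included: a loop with one half moved becomes an edge between the
    new vertex and [y]. *)
Lemma mult_split_new z : @mult split_graph S' None (Some z) = m z.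
Proof.
rewrite multE // SS'; apply: eq_card => h; rewrite !inE !hend_split /split_end.
case: (boolP (h \in D)) => hD; rewrite ?andbF //.
by rewrite (negPf (Dflip hD)) (Dy hD) !eqxx andbT.
Qed.

Lemma mult_split_old z :
  z != y -> @mult split_graph S' (Some y) (Some z) = mult S y z - m z.
Proof.
move=> zy; have yz : y != z by rewrite eq_sym.
rewrite !multE // SS' /m -cardsD; apply: eq_card => h.
rewrite !inE !hend_split /split_end.
case: (boolP (h \in D)) => hD; rewrite ?andbF //=.
by case: ifP => // fD; rewrite (Dy fD) (negPf yz) !andbF.
Qed.

Lemma mult_split_other w z : w != y -> z != y -> w != z ->
  @mult split_graph S' (Some w) (Some z) = mult S w z.
Proof.
move=> wy zy wz; rewrite !multE // SS'; apply: eq_card => h.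
rewrite !inE !hend_split /split_end; rewrite ![_ == y]eq_sym in wy zy.
by case: ifP => hD; case: ifP => fD;
   rewrite ?(Dy hD) ?(Dy fD) ?(negPf wy) ?(negPf zy) ?andbF.
Qed.

Lemma loops_split_new : @loops split_graph S' None = 0.
Proof.
apply/eqP; rewrite -(eqn_pmul2l (m := 2)) // loopsE muln0 cards_eq0.
apply/eqP/setP => h; rewrite !inE !hend_split /split_end.
by case: (boolP (h \in D)) => hD; rewrite ?andbF // (negPf (Dflip hD)) !andbF.
Qed.

Lemma loops_split_other w : w != y -> @loops split_graph S' (Some w) = loops S w.
Proof.
move=> wy; apply/eqP; rewrite -(eqn_pmul2l (m := 2)) // !loopsE SS'; apply/eqP.
apply: eq_card => h.
rewrite !inE !hend_split /split_end; rewrite [_ == y]eq_sym in wy.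
by case: ifP => hD; case: ifP => fD; rewrite ?(Dy hD) ?(Dy fD) ?(negPf wy) ?andbF.
Qed.

Lemma loops_split_old :
  m y <= loops S y /\ @loops split_graph S' (Some y) = loops S y - m y.
Proof.
pose L := hinges2 (edges S) y y.
have mF : m y = #|L :&: (@flip _ @^-1: D)|.
  rewrite /m -(card_preimset _ (can_inj (@flipK (edge G)))).
  by apply: eq_card => h; rewrite !inE flipK /= [(hend (flip h) == y) && _]andbC.
have disj : L :&: D \subset L :\: (@flip _ @^-1: D).
  by apply/subsetP => h /setIP[hL hD]; rewrite !inE in hL *; rewrite hL (Dflip hD).
have c1 := cardsID (@flip _ @^-1: D) L.
have c2 := subset_leq_card disj.
have e2 : 2 * loops S y = #|L| by rewrite loopsE.
(* A loop survives exactly when neither of its halves is moved. *)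
have e3 : 2 * @loops split_graph S' (Some y) = #|L :\: (@flip _ @^-1: D) :\: D|.
  rewrite loopsE SS'; apply: eq_card => h; rewrite !inE !hend_split /split_end.
  by case: (h \in D); case: (flip h \in D); rewrite /= ?andbF.
have c4 := cardsD (L :\: (@flip _ @^-1: D)) D.
have e4 : (L :\: (@flip _ @^-1: D)) :&: D = L :&: D.
  apply/eqP; rewrite eqEsubset setSI ?subsetDl //=.
  by rewrite subsetI disj subsetIr.
rewrite e4 -/(m y) in c4; rewrite -mF in c1; rewrite -/(m y) in c2.
lia.
Qed.

Section Reconnect.
Variable n : nat.
Hypothesis n1 : 1 < n.
Hypothesis ev : forall w, 2 %| deg S w.
Hypothesis wingD : forall r, napprox #|wing S y r :&: D| #|wing S y r| n.

Let adj' := @adj split_graph S'.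
Let sym' : connect_sym adj' := @connect_sym_adj split_graph S'.

(** The wing containing [h] is even and nonempty, and not all of it is moved; a remaining half-edge
    leads back to [y] through the component. *)
Lemma split_reattached h : h.1 \in edges S -> h \in D -> hend (flip h) != y ->
  connect adj' (Some (hend (flip h))) (Some y).
Proof.
move=> hS hD fy; set z := hend (flip h).
have hW : h \in wing S y z by rewrite inE hS (Dy hD) eqxx fy /=.
have W0 : 0 < #|wing S y z| by apply/card_gt0P; exists h.
have W2 : 2 <= #|wing S y z| by apply: dvdn_leq W0 _; apply: wing_even.
have [g] : exists g, g \in wing S y z :\: D.
  apply/set0Pn; rewrite -card_gt0 cardsD subn_gt0.
  suff : #|wing S y z :&: D| <= #|wing S y z|.-1 by lia.
  (* For w >= 2 and n >= 2, w <= (w - 1) n, hence ceil(w / n) <= w - 1. *)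
  by apply: (wingD z).2; nia.
rewrite inE inE => /andP[gD /and4P[gS /eqP gy fgy con]].
apply: (@connect_trans _ _ (Some (hend (flip g)))); last first.
  apply/connect1/adjP; exists (flip g); rewrite SS' !hend_split flipK; split=> //.
    by rewrite /split_end; case: ifP => // /Dy /eqP; rewrite (negPf fgy).
  by rewrite /split_end (negPf gD) gy.
(* Paths in S - y survive, since [D] contains only half-edges at [y]. *)
move: con; move: (hend (flip g)) => w.
apply: (connect_homo (f := Some)) => u v /and3P[uy vy /adjP[f [fS fu fv]]].
apply/connect1/adjP; exists f; rewrite SS' !hend_split; split=> //.
  by rewrite /split_end; case: ifP => [/Dy|]; rewrite fu // => /eqP; rewrite (negPf uy).
by rewrite /split_end; case: ifP => [/Dy|]; rewrite fv // => /eqP; rewrite (negPf vy).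
Qed.

Lemma split_connect_old u v : connect (adj S) u v -> connect adj' (Some u) (Some v).
Proof.
apply: (connect_homo (f := Some)) => {}u {}v /adjP[h [hS hu hv]].
have [hD|hD] := boolP (h \in D).
  rewrite -hu (Dy hD); have [vy|] := eqVneq v y; first by rewrite vy.
  rewrite sym' -hv; exact: split_reattached.
have [fD|fD] := boolP (flip h \in D).
  rewrite -hv (Dy fD); have [uy|] := eqVneq u y; first by rewrite uy.
  by rewrite -hu -{1 2}(flipK h) => hy; apply: split_reattached => //; rewrite flipK.
apply/connect1/adjP; exists h; rewrite SS' !hend_split /split_end.
by rewrite (negPf hD) (negPf fD) hu hv.
Qed.

Lemma split_connect_new : 0 < t -> connect adj' None (Some y).
Proof.
case/card_gt0P => h /setIP[]; rewrite inE => /andP[hS _] hD.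
have N : adj' None (Some (hend (flip h))).
  apply/adjP; exists h; rewrite SS' !hend_split /split_end.
  by rewrite hD (negPf (Dflip hD)).
have [fy|fy] := eqVneq (hend (flip h)) y; first by rewrite fy in N; apply: connect1.
by apply: connect_trans (connect1 N) _; apply: split_reattached.
Qed.

(** The positivity conditions rule out an isolated [None], which would be separated from [y]
    although both have the image [y]. *)
Lemma split_connect a b :
  (0 < deg S y -> 0 < t) -> 0 < deg S (odflt y a) -> 0 < deg S (odflt y b) ->
  connect adj' a b = connect (adj S) (odflt y a) (odflt y b).
Proof.
move=> tpos pa pb; apply/idP/idP.
  apply: (connect_homo (f := odflt y)) => u v /adjP[h [hS hu hv]].
  apply/connect1/adjP; exists h; rewrite -SS' -hu -hv !hend_split.
  by rewrite !split_endK.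
have old c : 0 < deg S (odflt y c) -> connect adj' c (Some (odflt y c)).
  by case: c => [c|] //= /tpos; apply: split_connect_new.
move=> /split_connect_old con; apply: connect_trans (old a pa) _.
apply: connect_trans con _; rewrite sym'; exact: old.
Qed.

End Reconnect.

End Split.

(* [None] stands for the whole graph and [Some j] for the color class of j, so
   that (A1)-(A2), (A3)-(A4) and (A5)-(A6) are handled together. *)
Definition class_sub (G : mgraph) (k : nat) (c : edge G -> 'I_k)
    (o : option 'I_k) : subgraph G :=
  if o is Some j then color_class c j else whole G.

(** * The two laminar families of half-edges at a vertex *)

Section Families.
Variables (G : mgraph) (k : nat) (c : edge G -> 'I_k) (y : vertex G).

Let X o := edges (class_sub c o).

(** The sets [hinges2 [set e] y y] hold the two halves of a loop; balance on them keeps [D] from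
    taking both. *)
Definition color_family : {set {set edge G * bool}} :=
  [set hinges (X o) y | o in {: option 'I_k}] :|:
  ([set hinges2 [set e] y y | e in {: edge G}] :|:
   [set wing (color_class c p.1) y p.2 | p in {: 'I_k * vertex G}]).

(** A separate family, because the half-edges towards one neighbor can cross color classes. The
    neighbor [y] itself accounts for the loops. *)
Definition neighbor_family : {set {set edge G * bool}} :=
  [set hinges2 (X p.1) y p.2 | p in {: option 'I_k * vertex G}].

(** Color classes are disjoint, a loop has a single color and meets no wing, and wings of one color
    are given by components, hence equal or disjoint. *)
Lemma laminar_color_family : laminar color_family.
Proof.
have nhh o o' : nested (hinges (X o) y) (hinges (X o') y).
  case: o o' => [j|] [j'|].
  - have [->|jj] := eqVneq j j'; first by rewrite /nested subxx.
    apply: nested_disjoint => h; rewrite !inE => /andP[/eqP-> _] /andP[/eqP jj' _].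
    by rewrite jj' eqxx in jj.
  - by apply/or3P/Or31/subsetP => h; rewrite !inE => /andP[].
  - by apply/or3P/Or32/subsetP => h; rewrite !inE => /andP[].
  - by rewrite /nested subxx.
have nhl o e : nested (hinges (X o) y) (hinges2 [set e] y y).
  have [eo|eo] := boolP (e \in X o).
    by apply/or3P/Or32/subsetP => h; rewrite !inE => /and3P[/eqP-> -> _]; rewrite eo.
  apply: nested_disjoint => h; rewrite inE => /andP[ho _].
  by rewrite !inE => /andP[/eqP he _]; rewrite -he ho in eo.
have nhw o j r : nested (hinges (X o) y) (wing (color_class c j) y r).
  case: o => [j'|]; last first.
    by apply/or3P/Or32/subsetP => h; rewrite !inE => /and4P[_ -> _ _].
  have [->|jj] := eqVneq j' j.
    by apply/or3P/Or32/subsetP => h; rewrite !inE => /and4P[-> -> _ _].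
  apply: nested_disjoint => h; rewrite !inE => /andP[/eqP hj _] /and4P[/eqP hj' _ _ _].
  by rewrite -hj hj' eqxx in jj.
have nll e e' : nested (@hinges2 G [set e] y y) (hinges2 [set e'] y y).
  have [->|ee] := eqVneq e e'; first by rewrite /nested subxx.
  apply: nested_disjoint => h; rewrite !inE => /andP[/eqP-> _] /andP[/eqP ee' _].
  by rewrite ee' eqxx in ee.
have nlw e j r : nested (hinges2 [set e] y y) (wing (color_class c j) y r).
  apply: nested_disjoint => h; rewrite !inE => /and3P[_ _ fy] /and4P[_ _ nfy _].
  by rewrite fy in nfy.
have nww j r j' r' :
    nested (wing (color_class c j) y r) (wing (color_class c j') y r').
  have [<-|jj] := eqVneq j j'; last first.
    apply: nested_disjoint => h; rewrite !inE => /and4P[/eqP hj _ _ _].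
    by case/and4P=> /eqP hj' _ _ _; rewrite -hj hj' eqxx in jj.
  have csym := sym_connect_sym (adj_off_sym (color_class c j) y).
  have [con|ncon] := boolP (connect (adj_off (color_class c j) y) r r').
    apply/or3P/Or31/subsetP => h; rewrite !inE => /and4P[-> -> -> /=].
    by apply: connect_trans; rewrite csym.
  apply: nested_disjoint => h; rewrite !inE => /and4P[_ _ _ c1] /and4P[_ _ _ c2].
  by case/negP: ncon; apply: connect_trans c1 _; rewrite csym.
move=> P Q.
case/setUP=> [/imsetP[o _ ->]|/setUP[/imsetP[e _ ->]|/imsetP[p _ ->]]];
case/setUP=> [/imsetP[o' _ ->]|/setUP[/imsetP[e' _ ->]|/imsetP[p' _ ->]]] //;
by rewrite nestedC.
Qed.

Lemma laminar_neighbor_family : laminar neighbor_family.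
Proof.
move=> P Q /imsetP[[o z] _ ->] /imsetP[[o' z'] _ ->] /=.
have [<-|zz] := eqVneq z z'; last first.
  apply: nested_disjoint => h; rewrite inE => /and3P[_ _ /eqP hz].
  by rewrite inE => /and3P[_ _ /eqP hz']; rewrite -hz hz' eqxx in zz.
case: o o' => [j|] [j'|].
- have [->|jj] := eqVneq j j'; first by rewrite /nested subxx.
  apply: nested_disjoint => h; rewrite !inE => /andP[/eqP-> _] /andP[/eqP jj' _].
  by rewrite jj' eqxx in jj.
- by apply/or3P/Or31/subsetP => h; rewrite !inE => /andP[].
- by apply/or3P/Or32/subsetP => h; rewrite !inE => /andP[].
- by rewrite /nested subxx.
Qed.

Lemma split_half_edges (n : nat) : 1 < n ->
  exists D : {set edge G * bool},
    [/\ (forall h, h \in D -> hend h = y),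
        (forall h, h \in D -> flip h \notin D),
        (forall o, napprox #|hinges (X o) y :&: D| #|hinges (X o) y| n),
        (forall o z, napprox #|hinges2 (X o) y z :&: D| #|hinges2 (X o) y z| n)
      & forall j r, napprox #|wing (color_class c j) y r :&: D|
                            #|wing (color_class c j) y r| n].
Proof.
move=> n1.
have [D0 D0P] := equitable_subset laminar_color_family laminar_neighbor_family (ltnW n1).
(* [D0] may contain half-edges away from [y]; discarding them does not affect the sets of the
   families, which all lie at [y]. *)
pose D := hinges (X None) y :&: D0.
have DP P : P \in color_family :|: neighbor_family -> P \subset hinges (X None) y ->
    napprox #|P :&: D| #|P| n.
  by move=> PU /setIidPl sub; rewrite setIA sub; apply: D0P.
have Dy h : h \in D -> hend h = y by rewrite !inE => /andP[/eqP].
exists D; split=> [//|h hD|o|o z|j r].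
- apply/negP => fD.
  have hy := Dy _ hD; have fy := Dy _ fD.
  have /DP[|_ /(_ 1)] : hinges2 [set h.1] y y \in color_family :|: neighbor_family.
    by apply/setUP; left; apply/setUP; right; apply/setUP; left;
       apply/imsetP; exists h.1.
    by apply/subsetP => g; rewrite !inE => /and3P[_ -> _].
  have le2 : #|hinges2 [set h.1] y y| <= 1 * n.
    rewrite card_hinges big_set1 mul1n; apply: leq_trans n1.
    by case: (_ && _); case: (_ && _).
  move=> /(_ le2); apply/negP; rewrite -ltnNge.
  have sub : [set h; flip h] \subset hinges2 [set h.1] y y :&: D.
    apply/subsetP => g; rewrite in_set2 => /orP[]/eqP->.
      by rewrite inE hD andbT !inE hy fy !eqxx.
    by rewrite inE fD andbT !inE flipK hy fy !eqxx.
  apply: leq_trans (subset_leq_card sub); rewrite cards2.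
  by case: h {hD fD hy fy le2 sub} => e b; rewrite /flip xpair_eqE eqxx; case: b.
- apply: DP; first by apply/setUP; left; apply/setUP; left; apply/imsetP; exists o.
  by apply/subsetP => h; rewrite !inE => /andP[_ ->].
- apply: DP; first by apply/setUP; right; apply/imsetP; exists (o, z).
  by apply/subsetP => h; rewrite !inE => /and3P[_ -> _].
- apply: DP; last by apply/subsetP => h; rewrite !inE => /and4P[_ -> _ _].
  apply/setUP; left; apply/setUP; right; apply/setUP; right.
  by apply/imsetP; exists (j, r).
Qed.

End Families.

(** * Fair detachments *)

(* The detachment keeps the edges of H, so its edge bijection is the identity. *)
Record fair_detachment (H : mgraph) (k : nat) (c : edge H -> 'I_k)
    (eta : vertex H -> nat) (V : finType) (en : edge H -> V * V)
    (psi : V -> vertex H) : Prop := FairDetachment {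
  fd_ends : forall e, ends e = (psi (en e).1, psi (en e).2);
  fd_fiber : forall w, #|[set u | psi u == w]| = eta w;
  fd_loopless : loopless (MGraph en);
  fd_deg : forall o u,
    napprox (@deg (MGraph en) (@class_sub (MGraph en) k c o) u)
            (deg (class_sub c o) (psi u)) (eta (psi u));
  fd_loops : forall o u v, u != v -> psi u = psi v ->
    napprox (@mult (MGraph en) (@class_sub (MGraph en) k c o) u v)
            (loops (class_sub c o) (psi u)) 'C(eta (psi u), 2);
  fd_mult : forall o u v, psi u != psi v ->
    napprox (@mult (MGraph en) (@class_sub (MGraph en) k c o) u v)
            (mult (class_sub c o) (psi u) (psi v)) (eta (psi u) * eta (psi v));
  fd_connect : forall j,
    (forall w, 2 * eta w %| deg (color_class c j) w) ->
    forall u v, 0 < deg (color_class c j) (psi u) ->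
      0 < deg (color_class c j) (psi v) ->
      connect (@adj (MGraph en) (@color_class (MGraph en) k c j)) u v =
      connect (adj (color_class c j)) (psi u) (psi v) }.

Lemma fair_detachment_id (H : mgraph) (k : nat) (c : edge H -> 'I_k)
    (eta : vertex H -> nat) :
  (forall w, eta w = 1) -> loopless H -> fair_detachment c eta (@ends H) id.
Proof.
case: H c eta => V E en c eta eta1 ll; split=> //=.
- by move=> e; case: (en e).
- move=> w; rewrite eta1 -(cards1 w); apply: eq_card => u.
  by rewrite !inE.
- by move=> o u; rewrite eta1; apply: napprox_refl.
- by move=> o u v /eqP.
- by move=> o u v _; rewrite !eta1; apply: napprox_refl.
Qed.

Lemma sum_option (T : finType) (y : T) (F : option T -> nat) :
  \sum_a F a = F None + \sum_x F (Some x).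
Proof.
rewrite (bigD1 None) //= (reindex_onto Some (odflt y)) /=; last by case.
by congr (_ + _); apply: eq_bigl => x; rewrite eqxx.
Qed.

Lemma napprox_exact (x q n : nat) : 0 < n -> napprox x (q * n) n -> x = q.
Proof. by move=> n0 [lo hi]; apply/eqP; rewrite eqn_leq hi ?lo. Qed.

(** * Lifting a fair detachment of the split graph *)

Section SplitStep.
Variables (H : mgraph) (k : nat) (c : edge H -> 'I_k) (eta : vertex H -> nat).
Variables (y : vertex H) (D : {set edge H * bool}).
Hypothesis eta_gt0 : forall w, 0 < eta w.
Hypothesis y1 : 1 < eta y.
Hypothesis Dy : forall h, h \in D -> hend h = y.
Hypothesis Dflip : forall h, h \in D -> flip h \notin D.

Let S o := class_sub c o.
Let S' o := @class_sub (split_graph D) k c o.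
Let SS' o : edges (S' o) = edges (S o).
Proof. by case: o. Qed.

Hypothesis Ddeg : forall o,
  napprox #|hinges (edges (S o)) y :&: D| #|hinges (edges (S o)) y| (eta y).
Hypothesis Dmult : forall o z,
  napprox #|hinges2 (edges (S o)) y z :&: D| #|hinges2 (edges (S o)) y z| (eta y).
Hypothesis Dwing : forall j r,
  napprox #|wing (color_class c j) y r :&: D| #|wing (color_class c j) y r| (eta y).

Definition split_eta (a : option (vertex H)) : nat :=
  if a is Some w then if w == y then (eta y).-1 else eta w else 1.

Lemma split_eta_gt0 a : 0 < split_eta a.
Proof. by case: a => //= w; case: ifP => // _; move: y1; case: (eta y) => [|[]]. Qed.

(** This sum counts the splits still to be made and is the measure of the induction. *)
Lemma split_eta_sum : \sum_a (split_eta a).-1 < \sum_w (eta w).-1.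
Proof.
rewrite (sum_option y) /= add0n (bigD1 y) //= [X in _ < X](bigD1 y) //= eqxx.
rewrite (eq_bigr (fun w => (eta w).-1)) => [|w /negPf->//].
by rewrite ltn_add2r; lia.
Qed.

Let loopsD o : napprox #|hinges2 (edges (S o)) y y :&: D| (2 * loops (S o) y) (eta y).
Proof. by rewrite loopsE; apply: Dmult. Qed.

Lemma split_eta1 :
  (forall w, eta w = 1 -> loops (whole H) w = 0) ->
  forall a, split_eta a = 1 -> loops (whole (split_graph D)) a = 0.
Proof.
move=> eta1 [w|] /=; last by move=> _; apply: (loops_split_new Dflip).
have [->|wy] := eqVneq w y => e1; last first.
  by rewrite (loops_split_other Dy (SS' None)) ?eta1.
(* In this case [D] takes at least half of the 2 l loop half-edges at [y], hence one from every
   loop, and no loop is left. *)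
have e2 : eta y = 2 by lia.
have [_ ->] := loops_split_old y Dflip (SS' None).
apply/eqP; rewrite subn_eq0; have [lo _] := loopsD None.
by apply: lo; rewrite e2 mulnC.
Qed.

Variables (V : finType) (en : edge H -> V * V) (psi : V -> option (vertex H)).
Hypothesis fd : @fair_detachment (split_graph D) k c split_eta V en psi.

Let phi u := odflt y (psi u).

Let new_unique u v : psi u = None -> psi v = None -> u = v.
Proof.
move=> pu pv; have /eqP/cards1P[x ex] := fd_fiber fd None.
have : u \in [set x] by rewrite -ex inE pu.
have : v \in [set x] by rewrite -ex inE pv.
by rewrite !inE => /eqP-> /eqP->.
Qed.

Let etaE w : w != y -> split_eta (Some w) = eta w.
Proof. by move=> /negPf /= ->. Qed.

Let etay : split_eta (Some y) = (eta y).-1.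
Proof. by rewrite /= eqxx. Qed.

Lemma split_fd_fiber w : #|[set u | phi u == w]| = eta w.
Proof.
rewrite -(cardsID [set u | psi u == None]).
have [->|wy] := eqVneq w y.
  have -> : #|[set u | phi u == y] :&: [set u | psi u == None]| = 1.
    rewrite -[RHS](fd_fiber fd None); apply: eq_card => u; rewrite !inE /phi.
    by case: (psi u) => [a|] /=; rewrite ?eqxx ?andbF.
  have -> : #|[set u | phi u == y] :\: [set u | psi u == None]| = (eta y).-1.
    rewrite -etay -(fd_fiber fd (Some y)); apply: eq_card => u; rewrite !inE /phi.
    by case: (psi u).
  by lia.
rewrite -(etaE wy) -(fd_fiber fd (Some w)) -[RHS]add0n; congr (_ + _).
  apply/eqP; rewrite cards_eq0; apply/eqP/setP => u; rewrite !inE /phi.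
  by case: (psi u) => [a|] /=; rewrite ?andbF // eq_sym (negPf wy).
by apply: eq_card => u; rewrite !inE /phi; case: (psi u).
Qed.

Lemma split_fd_deg o u :
  napprox (@deg (MGraph en) (@class_sub (MGraph en) k c o) u)
          (deg (S o) (phi u)) (eta (phi u)).
Proof.
have h := fd_deg fd o u; rewrite -/(S' o) in h; rewrite /phi.
case: (psi u) h => [w|] /=; last first.
  rewrite (deg_split_new Dy (SS' o)) => h.
  by rewrite -[eta y]muln1; apply: napprox_mul h; rewrite degE.
have [->|wy] := eqVneq w y; last by rewrite (deg_split_other Dy (SS' o) wy).
rewrite (deg_split_old y (SS' o)) -[(eta y).-1]muln1 => h.
rewrite -[eta y]muln1.
apply: napprox_rest h; rewrite ?degE //.
  exact: subset_leq_card (subsetIl _ _).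
Qed.

(** Over [y], either both vertices come from the old vertex and share its remaining loops, or one is
    the new vertex and the edges come from split loops. *)
Lemma split_fd_loops o u v : u != v -> phi u = phi v ->
  napprox (@mult (MGraph en) (@class_sub (MGraph en) k c o) u v)
          (loops (S o) (phi u)) 'C(eta (phi u), 2).
Proof.
have key u' v' : psi u' = None -> psi v' = Some y ->
    napprox (@mult (MGraph en) (@class_sub (MGraph en) k c o) u' v')
            (loops (S o) y) 'C(eta y, 2).
  move=> pu pv; have := fd_mult fd o (u := u') (v := v').
  rewrite -/(S' o) pu pv etay mul1n (mult_split_new Dy Dflip (SS' o)) => /(_ isT).
  exact: napprox_loops_new.
move=> uv; rewrite /phi; case pu: (psi u) => [a|]; case pv: (psi v) => [b|] /=.
- move=> ab; rewrite -{}ab in pv.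
  have := fd_loops fd o uv; rewrite -/(S' o) pu pv => /(_ erefl).
  have [->|ay] := eqVneq a y; last first.
    by rewrite etaE // (loops_split_other Dy (SS' o)).
  have [le ->] := loops_split_old y Dflip (SS' o).
  by rewrite etay; apply: napprox_loops_rest.
- by move=> ay; rewrite ay multC in pu *; apply: key.
- by move=> yb; rewrite -yb in pv; apply: key.
- by rewrite (new_unique pu pv) eqxx in uv.
Qed.

Lemma split_fd_mult o u v : phi u != phi v ->
  napprox (@mult (MGraph en) (@class_sub (MGraph en) k c o) u v)
          (mult (S o) (phi u) (phi v)) (eta (phi u) * eta (phi v)).
Proof.
have key u' v' z : phi u' = y -> z != y -> psi v' = Some z ->
    napprox (@mult (MGraph en) (@class_sub (MGraph en) k c o) u' v')
            (mult (S o) y z) (eta y * eta z).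
  move=> pu zy pv; have := fd_mult fd o (u := u') (v := v').
  have yz : y != z by rewrite eq_sym.
  rewrite -/(S' o) pv etaE // (multE _ yz).
  move: pu; rewrite /phi; case: (psi u') => [a|] /=.
    move=> -> /(_ yz); rewrite eqxx (mult_split_old Dy (SS' o) zy) (multE _ yz).
    by apply: napprox_rest => //; apply: subset_leq_card (subsetIl _ _).
  move=> _ /(_ isT); rewrite mul1n (mult_split_new Dy Dflip (SS' o)).
  exact: napprox_mul.
have lift a : phi a != y -> psi a = Some (phi a).
  by rewrite /phi; case: (psi a) => //=; rewrite eqxx.
have [uy uv|uy] := eqVneq (phi u) y.
  have vy : phi v != y by rewrite -uy eq_sym.
  by rewrite uy; apply: key (lift _ vy).
have [vy _|vy uv] := eqVneq (phi v) y.
  by rewrite multC [mult (S o) _ _]multC mulnC vy; apply: key (lift _ uy).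
have := fd_mult fd o (u := u) (v := v).
rewrite -/(S' o) (lift _ uy) (lift _ vy) => /(_ uv).
by rewrite !etaE // (mult_split_other Dy (SS' o)).
Qed.

Lemma split_fd_connect j :
  (forall w, 2 * eta w %| deg (color_class c j) w) ->
  forall u v, 0 < deg (color_class c j) (phi u) ->
    0 < deg (color_class c j) (phi v) ->
    connect (@adj (MGraph en) (@color_class (MGraph en) k c j)) u v =
    connect (adj (color_class c j)) (phi u) (phi v).
Proof.
move=> ev u v.
have Sj := SS' (Some j); pose Hj := color_class c j.
have [q dq] : exists q, deg Hj y = q * (2 * eta y) by apply/dvdnP.
(* The degree is a multiple of the number of parts, so the share is exact: 2 q half-edges move and 2
   q (eta y - 1) stay. Both are even shares, so the divisibility passes to the split graph. *)
have tE : #|hinges (edges Hj) y :&: D| = 2 * q.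
  apply: (@napprox_exact _ _ (eta y)) => //.
  have -> : 2 * q * eta y = deg Hj y by lia.
  by rewrite degE; apply: (Ddeg (Some j)).
have ev' a : 2 * split_eta a %| @deg (split_graph D) (S' (Some j)) a.
  case: a => [w|] /=; last by rewrite (deg_split_new Dy Sj) tE muln1 dvdn_mulr.
  have [->|wy] := eqVneq w y; last by rewrite (deg_split_other Dy Sj).
  rewrite (deg_split_old y Sj) -/Hj tE dq; apply/dvdnP; exists q.
  by case: (eta y) (eta_gt0 y) => // n _; lia.
have pos a : 0 < deg Hj (odflt y a) -> 0 < @deg (split_graph D) (S' (Some j)) a.
  case: a => [w|] /=; last by rewrite (deg_split_new Dy Sj) tE dq; lia.
  have [->|wy] := eqVneq w y; last by rewrite (deg_split_other Dy Sj).
  by rewrite (deg_split_old y Sj) -/Hj tE dq; move: y1; nia.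
move=> pu pv; rewrite (fd_connect fd ev' (pos _ pu) (pos _ pv)).
apply: (split_connect Dy Dflip Sj y1 _ (Dwing j)) => //.
  by move=> w; apply: dvdn_trans (ev w); apply: dvdn_mulr.
by rewrite -/Hj tE dq; lia.
Qed.

Lemma split_fair_detachment : fair_detachment c eta en phi.
Proof.
split.
- move=> e; have := fd_ends fd e; rewrite /phi /= => -[<- <-].
  by rewrite !split_endK // /hend /= -surjective_pairing.
- exact: split_fd_fiber.
- exact: fd_loopless fd.
- exact: split_fd_deg.
- exact: split_fd_loops.
- exact: split_fd_mult.
- exact: split_fd_connect.
Qed.

End SplitStep.

Lemma fair_detachment_exists (H : mgraph) (k : nat) (c : edge H -> 'I_k)
    (eta : vertex H -> nat) :
  (forall w, 0 < eta w) -> (forall w, eta w = 1 -> loops (whole H) w = 0) ->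
  exists (V : finType) (en : edge H -> V * V) (psi : V -> vertex H),
    fair_detachment c eta en psi.
Proof.
have [N] := ubnP (\sum_w (eta w).-1).
elim: N H c eta => // N IH H c eta ltN eta_gt0 eta1.
have [/forallP all1|] := boolP [forall w, eta w == 1].
  have {}all1 w : eta w = 1 by apply/eqP.
  exists (vertex H), (@ends H), id; apply: fair_detachment_id => // w.
  exact: eta1.
rewrite negb_forall => /existsP[y ny].
have y1 : 1 < eta y by rewrite ltn_neqAle eq_sym ny eta_gt0.
have [D [Dy Dflip Ddeg Dmult Dwing]] := split_half_edges c y y1.
have [||| V [en [psi fd]]] := IH (split_graph D) c (split_eta eta y).
- by apply: leq_trans (split_eta_sum y1) _.
- exact: split_eta_gt0.
- exact: split_eta1 Dmult eta1.
exists V, en, (fun u => odflt y (psi u)).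
exact: split_fair_detachment fd.
Qed.

(** * Counting components and conclusion *)

Lemma mem_color_verts (G : mgraph) (k : nat) (c : edge G -> 'I_k) j u :
  (u \in verts (color_class c j)) = (0 < deg (color_class c j) u).
Proof.
rewrite degE inE; apply/existsP/card_gt0P => [[e /andP[ej]]|[[e b]]].
  case/orP => eu; [exists (e, false)|exists (e, true)];
  by rewrite inE ej.
rewrite inE => /andP[/= ej eu]; exists e; rewrite ej /incident.
by case: b eu; rewrite /hend /= => ->; rewrite ?orbT.
Qed.

Lemma verts_closed (G : mgraph) (S : subgraph G) : closed (adj S) (verts S).
Proof.
have sub u v : adj S u v -> u \in verts S.
  case/existsP => e /andP[eS euv]; apply: edges_closed eS _; move: euv.
  by rewrite /joins /incident => /orP[]/eqP->; rewrite /= eqxx ?orbT.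
by move=> u v uv; rewrite (sub _ _ uv); rewrite adj_sym in uv; rewrite (sub _ _ uv).
Qed.

Lemma fair_detachment_ncomponents (H : mgraph) (k : nat) (c : edge H -> 'I_k)
    (eta : vertex H -> nat) (V : finType) (en : edge H -> V * V)
    (psi : V -> vertex H) (j : 'I_k) :
  (forall w, 0 < eta w) -> fair_detachment c eta en psi ->
  (forall w, 2 * eta w %| deg (color_class c j) w) ->
  ncomponents (@color_class (MGraph en) k c j) = ncomponents (color_class c j).
Proof.
move=> eta_gt0 fd ev; set Hj := color_class c j; set Gj := @color_class (MGraph en) k c j.
(* Degrees in the color class are divided exactly, so a vertex has positive degree if and only if
   its image does. *)
have vGH u : (u \in verts Gj) = (psi u \in verts Hj).
  rewrite !mem_color_verts; have := fd_deg fd (Some j) u => /=.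
  have /dvdnP[q dq] := ev (psi u); rewrite -/Gj -/Hj in dq *.
  rewrite {1}dq mulnA => /(napprox_exact (eta_gt0 _)) ->; rewrite dq.
  by have := eta_gt0 (psi u); lia.
have adjn : rel_adjunction psi (adj Hj) (adj Gj) (verts Hj).
  split=> [w wH|u v].
    have /card_gt0P/sigW[u] : 0 < #|[set u | psi u == w]| by rewrite (fd_fiber fd).
    by rewrite inE => /eqP uw; exists u; rewrite uw connect0.
  move=> uH0; have uH : psi u \in verts Hj := uH0.
  have [vH|vH] := boolP (psi v \in verts Hj).
    by apply: (fd_connect fd) => //; rewrite -mem_color_verts.
  (* When only one of the two vertices lies in the color class, both sides are false, because the
     vertex sets are closed under adjacency. *)
  apply/idP/idP => /closed_connect con.
    by have := con _ (@verts_closed _ Gj); rewrite !vGH uH (negPf vH).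
  by have := con _ (@verts_closed _ Hj); rewrite uH (negPf vH).
rewrite /ncomponents (adjunction_n_comp psi (connect_sym_adj Hj) (connect_sym_adj Gj)
   (@verts_closed _ Hj) adjn).
by apply: eq_n_comp_r => u; rewrite vGH !inE.
Qed.

Lemma even_integer_dvdn (R : archiRealFieldType) (a n : nat) :
  0 < n -> even_integer (a%:R / n%:R : R)%R -> 2 * n %| a.
Proof.
move=> n0 [q eq]; apply/dvdnP; exists `|q|%N.
have n0R : (n%:R != 0 :> R)%R by rewrite pnatr_eq0 -lt0n.
have : ((a%:Z)%:~R = (2 * q * n%:Z)%:~R :> R)%R.
  by rewrite intrM -eq divfK.
move=> /intr_inj e; have := congr1 absz e; rewrite !abszM /= => ->; lia.
Qed.

Local Open Scope ring_scope.

Theorem theorem2 (R : archiRealFieldType) (H : mgraph) (k : nat)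
    (c : edge H -> 'I_k) (eta : vertex H -> nat)
    (eta_gt0 : forall w : vertex H, (0 < eta w)%N)
    (eta1 : forall w : vertex H, eta w = 1%N -> loops (whole H) w = 0%N) :
  exists (G : mgraph) (psi : vertex G -> vertex H) (f : edge G -> edge H),
    let Hj (j : 'I_k) := color_class c j in
    let Gj (j : 'I_k) := color_class (fun e => c (f e)) j in
    amalgamation psi f /\
    (forall w : vertex H, number_function psi w = eta w) /\
    loopless G /\
    (* (A1) *)
    (forall (w : vertex H) (u : vertex G), psi u = w ->
       approx ((deg (whole G) u)%:R : R)
              ((deg (whole H) w)%:R / (eta w)%:R)) /\
    (* (A2) *)
    (forall (w : vertex H) (u : vertex G) (j : 'I_k), psi u = w ->
       approx ((deg (Gj j) u)%:R : R)
              ((deg (Hj j) w)%:R / (eta w)%:R)) /\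
    (* (A3) *)
    (forall (w : vertex H) (u u' : vertex G), (2 <= eta w)%N ->
       psi u = w -> psi u' = w -> u <> u' ->
       approx ((mult (whole G) u u')%:R : R)
              ((loops (whole H) w)%:R / 'C(eta w, 2)%:R)) /\
    (* (A4) *)
    (forall (w : vertex H) (u u' : vertex G) (j : 'I_k), (2 <= eta w)%N ->
       psi u = w -> psi u' = w -> u <> u' ->
       approx ((mult (Gj j) u u')%:R : R)
              ((loops (Hj j) w)%:R / 'C(eta w, 2)%:R)) /\
    (* (A5) *)
    (forall (w z : vertex H) (u v : vertex G), w <> z ->
       psi u = w -> psi v = z ->
       approx ((mult (whole G) u v)%:R : R)
              ((mult (whole H) w z)%:R / ((eta w)%:R * (eta z)%:R))) /\
    (* (A6) *)
    (forall (w z : vertex H) (u v : vertex G) (j : 'I_k), w <> z ->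
       psi u = w -> psi v = z ->
       approx ((mult (Gj j) u v)%:R : R)
              ((mult (Hj j) w z)%:R / ((eta w)%:R * (eta z)%:R))) /\
    (* (A7) *)
    (forall j : 'I_k,
       (forall w : vertex H,
          even_integer ((deg (Hj j) w)%:R / (eta w)%:R : R)) ->
       ncomponents (Gj j) = ncomponents (Hj j)).
Proof.
have [V [en [psi fd]]] := fair_detachment_exists c eta_gt0 eta1.
exists (MGraph en), psi, id => /=; split; last split; last split; last split;
  last split; last split; last split; last split; last split.
- split.
  + move=> w; have /card_gt0P[u] : (0 < #|[set u | psi u == w]|)%N.
      by rewrite (fd_fiber fd).
    by rewrite inE => /eqP; exists u.
  + by exists id.
  + move=> e w z; rewrite /joins (fd_ends fd e) /=; split.
      case: (en e) => a b /= /orP[]/eqP[<- <-].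
        by exists a, b; rewrite eqxx.
      by exists b, a; rewrite eqxx orbT.
    case=> u [v [<- <-]] /orP[]/eqP-> /=; by rewrite eqxx ?orbT.
- exact: fd_fiber fd.
- exact: fd_loopless fd.
- move=> w u <-; apply: napprox_approx => //; exact: fd_deg fd None u.
- move=> w u j <-; apply: napprox_approx => //; exact: fd_deg fd (Some j) u.
- move=> w u u' w2 uw; rewrite -{w}uw in w2 * => u'u /eqP uu'; apply: napprox_approx.
    by rewrite bin_gt0.
  by have := fd_loops fd None uu' (esym u'u).
- move=> w u u' j w2 uw; rewrite -{w}uw in w2 * => u'u /eqP uu'; apply: napprox_approx.
    by rewrite bin_gt0.
  by have := fd_loops fd (Some j) uu' (esym u'u).
- move=> w z u v /eqP wz uw vz; subst w z; rewrite -natrM.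
  apply: napprox_approx; first by rewrite muln_gt0 !eta_gt0.
  by have := fd_mult fd None wz.
- move=> w z u v j /eqP wz uw vz; subst w z; rewrite -natrM.
  apply: napprox_approx; first by rewrite muln_gt0 !eta_gt0.
  by have := fd_mult fd (Some j) wz.
- move=> j ev; apply: (fair_detachment_ncomponents eta_gt0 fd) => w.
  exact: even_integer_dvdn (eta_gt0 w) (ev w).
Qed.
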